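(* Let $G=(V,E)$ be a finite graph, let $x$ be a number, and let $w:2^E\to\mathbb{Q}_{\ge 0}$ satisfy $w(\emptyset)=0$ and $w(A)=\prod_{e\in A}w(e)$ for each $\emptyset\neq A\subseteq E$ (where $w(e)=w(\{e\})$), so that the connectivity augmented game $w(G)$ is a couple game. Then the potential of $w(G)$ satisfies $$P(w(G))=\sum_{T\subseteq E,\ T\text{ flat}} w(T)\,C(G.T,x)=B\bigl(G,x,(w(e))_{e\in E}\bigr)-C(G,x),$$ where $C$ is the chromatic polynomial and $B$ is the multivariate bad coloring polynomial.
   Context: Graphs are finite; loops and multiple edges are allowed. ''Number'' may be read as complex number. The symbol $\subseteq$ allows equality. Components and flats: for $A\subseteq E$, $c(A)$ is the number of connected components of $(V,A)$. A set $A\subseteq E$ is flat if $c(A)>c(A\cup\{e\})$ for every $e\in E\setminus A$. Games: a cooperative game with finite player set $N$ is a function $v:2^N\to\mathbb{C}$ with $v(\emptyset)=0$; here the players are the edges of $G$. For $R\subseteq N$ put $c_R(v)=\sum_{T\subseteq R}(-1)^{|R|-|T|}v(T)$. Connectivity augmentation: for $\emptyset\neq R\subseteq E$, the basic connectivity augmented game is $b(R,G,x)(S)=|R|x^{c(R)}$ if $R\subseteq S\subseteq E$, and $0$ otherwise. The connectivity augmented game of $w$ is $w(G)=\sum_{\emptyset\neq R\subseteq E}c_R(w)\,b(R,G,x)$. It is called a couple game when $w(A)=\prod_{e\in A}w(e)$ for all $\emptyset\ne A\subseteq E$. Shapley value: for a player $e\in N$, $\phi_e(v)=\sum_{e\in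 R\subseteq N}\frac{1}{|R|}c_R(v)$. Potential: for a game $v$ on $N$ and $S\subseteq N$ let $v|_S$ be the restriction of $v$ to $2^S$. The potential $P$ is determined by $P(v|_\emptyset)=0$ and $P(v|_S)-P(v|_{S\setminus\{e\}})=\phi_e(v|_S)$ for all $S\subseteq N$ and $e\in S$; $P(v)=P(v|_N)$. Chromatic polynomial: for a graph $H=(V_H,E_H)$, $C(H,x)=\sum_{A\subseteq E_H}(-1)^{|A|}x^{c(A)}$, with $c(A)$ the number of connected components of $(V_H,A)$. Contraction: for $A\subseteq E$, $G.A$ is the graph whose vertices are the connected components of $(V,A)$ and which has exactly one edge for each $e\in E\setminus A$, joining the components containing the ends of $e$ (so loops and multiple edges may occur). Multivariate bad coloring polynomial: $B(G,x,(y_e)_{e\in E})=\sum_{A\subseteq E,\ A\text{ flat}}C(G.A,x)\prod_{e\in A}y_e$. *)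

(* Defs.v *)
From HB Require Import structures.
From mathcomp Require Import all_boot all_order all_algebra.
From mathcomp Require Import boolp reals.
From mathcomp Require Export complex.

Set Implicit Arguments.
Unset Strict Implicit.
Unset Printing Implicit Defensive.

Import Order.TTheory GRing.Theory Num.Theory.

Local Open Scope ring_scope.
Local Open Scope complex_scope.

(* Loops and multiple edges are allowed.  The ends of an edge are stored as an
   ordered pair for convenience: [adj] is symmetric, so the order is ignored. *)
Record multigraph := Multigraph {
  vertex : finType;
  edge : finType;
  ends : edge -> vertex * vertex }.

Definition adj (G : multigraph) (A : {set edge G}) : rel (vertex G) :=
  fun u v => [exists e in A, (ends e == (u, v)) || (ends e == (v, u))].

Definition component_of (G : multigraph) (A : {set edge G}) (v : vertex G) :
    {set vertex G} :=
  [set u | connect (adj A) v u].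

Definition components (G : multigraph) (A : {set edge G}) :
    {set {set vertex G}} :=
  [set component_of A v | v : vertex G].

Definition ncomponents (G : multigraph) (A : {set edge G}) : nat :=
  #|components A|.

Definition flat (G : multigraph) (A : {set edge G}) : bool :=
  [forall e, (e \notin A) ==> (ncomponents (e |: A) < ncomponents A)%N].

Lemma component_of_in (G : multigraph) (A : {set edge G}) (v : vertex G) :
  component_of A v \in components A.
Proof. exact: imset_f. Qed.

Definition contract_vertex (G : multigraph) (A : {set edge G}) : finType :=
  {X : {set vertex G} | X \in components A}.

Definition contract_proj (G : multigraph) (A : {set edge G}) (v : vertex G) :
    contract_vertex A :=
  exist _ (component_of A v) (component_of_in A v).

Definition contract_edge (G : multigraph) (A : {set edge G}) : finType :=
  {e : edge G | e \notin A}.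

Definition contract (G : multigraph) (A : {set edge G}) : multigraph :=
  @Multigraph (contract_vertex A) (contract_edge A)
    (fun e => (contract_proj A (ends (val e)).1,
               contract_proj A (ends (val e)).2)).

Definition chromatic (K : realType) (G : multigraph) (x : K[i]) : K[i] :=
  \sum_(A : {set edge G}) (-1) ^+ #|A| * x ^+ ncomponents A.

Definition bad_coloring (K : realType) (G : multigraph) (x : K[i])
    (y : edge G -> K[i]) : K[i] :=
  \sum_(A : {set edge G} | flat A)
     chromatic (contract A) x * \prod_(e in A) y e.

Record game (K : realType) (N : finType) := Game {
  worth :> {set N} -> K[i];
  worth0 : worth set0 = 0 }.

(* The coefficient c_Q(v) of v on the unanimity game of Q. *)
Definition dividend (K : realType) (N : finType) (v : game K N) (Q : {set N}) :
    K[i] :=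
  \sum_(T : {set N} | T \subset Q) (-1) ^+ (#|Q| - #|T|) * v T.

Definition shapley (K : realType) (N : finType) (v : game K N) (e : N) : K[i] :=
  \sum_(Q : {set N} | e \in Q) #|Q|%:R^-1 * dividend v Q.

Lemma restrict_subproof (K : realType) (N : finType) (v : game K N)
    (S : {set N}) :
  v [set val e | e in (set0 : {set {e : N | e \in S}})] = 0.
Proof. by rewrite imset0 worth0. Qed.

Definition restrict (K : realType) (N : finType) (v : game K N) (S : {set N}) :
    game K {e : N | e \in S} :=
  @Game K {e : N | e \in S} (fun A => v [set val e | e in A])
    (restrict_subproof v S).

(* [P S] stands for the potential of the restricted game [restrict v S]. *)
Definition is_potential (K : realType) (N : finType) (v : game K N)
    (P : {set N} -> K[i]) : Prop :=
  P set0 = 0 /\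
  forall (S : {set N}) (e : N) (eS : e \in S),
    P S - P (S :\ e) = shapley (restrict v S) (exist _ e eS).

Section PotentialWellDefined.

Context (K : realType) (N : finType) (v : game K N).

Let sum_restrict (S : {set N}) (p : pred {set N}) (F : {set N} -> K[i]) :
  \sum_(Q : {set {e : N | e \in S}} | p [set val e | e in Q])
     F [set val e | e in Q] =
  \sum_(Q : {set N} | (Q \subset S) && p Q) F Q.
Proof.
pose up (Q : {set {e : N | e \in S}}) : {set N} := [set val e | e in Q].
pose down (Q : {set N}) : {set {e : N | e \in S}} := [set e | val e \in Q].
have upS Q : up Q \subset S by apply/subsetP => _ /imsetP[e _ ->]; exact: valP.
have upK : cancel up down.
  by move=> Q; apply/setP => e; rewrite inE (mem_imset _ _ val_inj).
have downK (Q : {set N}) : Q \subset S -> up (down Q) = Q.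
  move=> /subsetP QS; apply/setP => e; apply/imsetP/idP => [[f]|eQ].
    by rewrite inE => fQ ->.
  by exists (Sub e (QS e eQ)); rewrite ?inE SubK.
rewrite [RHS](reindex_onto up down) => [|Q /andP[/downK]//].
by apply: eq_bigl => Q; rewrite upK eqxx andbT upS.
Qed.

Let dividend_restrict (S : {set N}) (Q : {set {e : N | e \in S}}) :
  dividend (restrict v S) Q = dividend v [set val e | e in Q].
Proof.
have QS : [set val e | e in Q] \subset S.
  by apply/subsetP => _ /imsetP[e _ ->]; exact: valP.
pose Q' := [set val e | e in Q].
rewrite /dividend (card_imset _ val_inj) /=.
transitivity (\sum_(T : {set N} | (T \subset S) && (T \subset Q'))
                (-1) ^+ (#|Q| - #|T|) * v T); last first.
  apply: eq_bigl => T; rewrite andb_idl // => TQ.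
  exact: subset_trans TQ QS.
rewrite -(sum_restrict S (fun T => T \subset Q')
            (fun T => (-1) ^+ (#|Q| - #|T|) * v T)).
apply: eq_big => [T|T _]; last by rewrite (card_imset _ val_inj).
apply/idP/idP => [/(imsetS val)//|/subsetP TQ].
apply/subsetP => e eT.
have := TQ (val e); rewrite !(mem_imset _ _ val_inj); exact.
Qed.

Let shapley_restrict (S : {set N}) (e : N) (eS : e \in S) :
  shapley (restrict v S) (exist _ e eS) =
  \sum_(Q : {set N} | (Q \subset S) && (e \in Q)) #|Q|%:R^-1 * dividend v Q.
Proof.
rewrite -(sum_restrict S (fun Q => e \in Q)
            (fun Q => #|Q|%:R^-1 * dividend v Q)).
apply: eq_big => [Q|Q _]; last first.
  by rewrite dividend_restrict (card_imset _ val_inj).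
by rewrite -[e in RHS]/(val (exist (fun e => e \in S) e eS))
           (mem_imset _ _ val_inj).
Qed.

Lemma potential_exists : exists P, is_potential v P.
Proof.
exists (fun S : {set N} =>
  \sum_(Q : {set N} | Q \subset S) #|Q|%:R^-1 * dividend v Q).
split=> [|S e eS].
  rewrite big1 // => Q; rewrite subset0 => /eqP ->.
  by rewrite cards0 invr0 mul0r.
rewrite shapley_restrict (bigID (fun Q : {set N} => e \in Q)) /=.
rewrite [X in _ + X - _](eq_bigl (fun Q : {set N} => Q \subset S :\ e)).
  by rewrite addrK.
by move=> Q; rewrite subsetD1.
Qed.

Lemma potential_unique (P P' : {set N} -> K[i]) :
  is_potential v P -> is_potential v P' -> P =1 P'.
Proof.
move=> [P0 PS] [P'0 P'S] S.
have [n] := ubnP #|S|; elim: n S => // n IHn S leSn.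
have [->|/set0Pn[e eS]] := eqVneq S set0; first by rewrite P0 P'0.
apply: (addIr (- P (S :\ e))); rewrite PS IHn ?P'S //.
by move: leSn; rewrite (cardsD1 e) eS.
Qed.

End PotentialWellDefined.

(* The chosen [P] is unique by [potential_unique]. *)
Definition potential (K : realType) (N : finType) (v : game K N) : K[i] :=
  sval (cid (potential_exists v)) [set: N].

(* Only used for nonempty [Q]; for [Q = set0] the factor #|Q| makes it zero. *)
Lemma basic_augmented_subproof (K : realType) (G : multigraph) (x : K[i])
    (Q : {set edge G}) :
  (if Q \subset set0 then #|Q|%:R * x ^+ ncomponents Q else 0) = 0 :> K[i].
Proof. by case: ifP => //; rewrite subset0 => /eqP ->; rewrite cards0 mul0r. Qed.

Definition basic_augmented (K : realType) (G : multigraph) (x : K[i])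
    (Q : {set edge G}) : game K (edge G) :=
  @Game K (edge G)
    (fun S => if Q \subset S then #|Q|%:R * x ^+ ncomponents Q else 0)
    (basic_augmented_subproof x Q).

Lemma augmented_subproof (K : realType) (G : multigraph)
    (w : game K (edge G)) (x : K[i]) :
  \sum_(Q : {set edge G} | Q != set0)
     dividend w Q * basic_augmented x Q set0 = 0.
Proof. by apply: big1 => Q _; rewrite worth0 mulr0. Qed.

Definition augmented (K : realType) (G : multigraph) (w : game K (edge G))
    (x : K[i]) : game K (edge G) :=
  @Game K (edge G)
    (fun S => \sum_(Q : {set edge G} | Q != set0)
                dividend w Q * basic_augmented x Q S)
    (augmented_subproof w x).

Lemma rat_game_subproof (K : realType) (N : finType) (w : {set N} -> rat) :
  w set0 = 0 -> ratr (w set0) = 0 :> K[i].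
Proof. by move=> ->; rewrite rmorph0. Qed.

Definition rat_game (K : realType) (N : finType) (w : {set N} -> rat)
    (w0 : w set0 = 0) : game K N :=
  @Game K N (fun A => ratr (w A)) (rat_game_subproof K w0).

(* Main.v *)
(* Since v(S) is the sum of its dividends over subsets of S, the potential of v
   is the sum of dividend v Q / |Q|, so the factor |Q| in the basic augmented
   games cancels and P(w(G)) is the sum over Q of c_Q(w) x^c(Q).  Expanding
   c_Q(w) and exchanging sums, the coefficient of w(T) is the alternating sum of
   x^c(Q) over Q containing T, which is C(G.T, x).  It vanishes for T not flat:
   such a T has an edge outside it joining two vertices of one component, and
   toggling that edge in Q flips the sign but keeps c(Q).  In B the
   empty set contributes C(G, x), also when it is not flat, both being 0 then. *)
Require Import Defs.
From mathcomp Require Import all_boot all_order all_algebra.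
From mathcomp Require Import boolp reals complex.

Set Implicit Arguments.
Unset Strict Implicit.
Unset Printing Implicit Defensive.

Import Order.TTheory GRing.Theory Num.Theory.

Local Open Scope ring_scope.
Local Open Scope complex_scope.

(** * Cancelling and transporting sums over subsets *)

Section SubsetSums.

Context (V : zmodType) (N : finType).
Implicit Types (e : N) (A B S T : {set N}).

Lemma subset_setU1 e A B : e \notin A -> (A \subset e |: B) = (A \subset B).
Proof.
move=> eA; rewrite -subDset.
by have /setDidPl -> : [disjoint A & [set e]] by rewrite disjoint_sym disjoints1.
Qed.

(** Sign-reversing involution: each set avoiding [e] is paired with the set obtained by adding [e],
    and the two terms cancel. *)
Lemma sum_toggle0 e (P : pred {set N}) (F : {set N} -> V) :
    (forall A, e \notin A -> P (e |: A) = P A) ->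
    (forall A, e \notin A -> P A -> F (e |: A) = - F A) ->
  \sum_(A | P A) F A = 0.
Proof.
move=> Pe Fe; rewrite (bigID (fun A : {set N} => e \in A)) /=.
rewrite (reindex_onto (setU [set e]) (fun A => A :\ e)) /=; last first.
  by move=> A /andP[_ eA]; rewrite setD1K.
rewrite (eq_bigl (fun A => P A && (e \notin A))) => [|A].
  rewrite (eq_bigr (fun A => - F A)) => [|A /andP[PA eA]]; last exact: Fe.
  by rewrite sumrN addNr.
rewrite setU11 andbT; have [eA|eA] := boolP (e \in A).
  rewrite andbF; apply/negbTE/nandP; right.
  by apply: contraTneq eA => <-; rewrite setD11.
by rewrite setU1K // eqxx Pe.
Qed.

(** Image and preimage under [val] are inverse bijections between subsets of the subtype and subsets
    of [sp]. This serves both restricted games and the edge sets of a contraction. *)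
Lemma sum_imset_val (p q : pred {set N}) (sp : pred N) (F : {set N} -> V) :
    (forall A, p A = (A \subset sp) && q A) ->
  \sum_(A : {set {e | sp e}} | q (val @: A)) F (val @: A) =
  \sum_(A | p A) F A.
Proof.
move=> pE; pose up (A : {set {e | sp e}}) : {set N} := val @: A.
pose down A : {set {e | sp e}} := val @^-1: A.
have downK A : A \subset sp -> up (down A) = A.
  move=> /subsetP sA; apply/setP => e; apply/imsetP/idP => [[f]|eA].
    by rewrite inE => fA ->.
  by exists (Sub e (sA e eA)); rewrite ?inE SubK.
rewrite [RHS](reindex_onto up down) => [|A]; last by rewrite pE => /andP[/downK].
apply: eq_bigl => A; rewrite pE.
have -> : down (up A) = A.
  by apply/setP => e; rewrite inE (mem_imset _ _ val_inj).
rewrite eqxx andbT andb_idl // => _.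
by apply/subsetP => _ /imsetP[e _ ->]; exact: valP.
Qed.

End SubsetSums.

(** * Dividends and the potential *)

(** Moebius inversion: the coefficient of [d A] is an alternating sum over the sets between [A] and
    [Q]. Toggling an element of [Q] outside [A] kills it unless [A = Q]. *)
Lemma dividend_of_sum (K : realType) (N : finType) (v : game K N)
    (d : {set N} -> K[i]) :
    (forall S, v S = \sum_(Q : {set N} | Q \subset S) d Q) ->
  dividend v =1 d.
Proof.
move=> vE Q; rewrite /dividend.
under eq_bigr do rewrite vE mulr_sumr.
rewrite (exchange_big_dep (fun A : {set N} => A \subset Q)) /=; last first.
  by move=> T A TQ AT; exact: subset_trans TQ.
rewrite (bigD1 Q) //= (big_pred1 Q) => [|T]; last first.
  by rewrite -eqEsubset.
rewrite subnn expr0 mul1r big1 ?addr0 // => A /andP[AQ neqAQ].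
have /properP[_ [e eQ eA]] : A \proper Q by rewrite properEneq neqAQ.
apply: (sum_toggle0 (e := e)) => T eT.
  by rewrite subUset sub1set eQ subset_setU1.
move=> /andP[TQ _].
(* Subtraction on naturals truncates; the strict inequality makes the exponent drop by exactly one
   when [e] joins [T]. *)
have ltTQ : (#|T| < #|Q|)%N.
  by apply: proper_card; apply/properP; split=> //; exists e.
by rewrite cardsU1 eT add1n -[(#|Q| - #|T|)%N]prednK ?subn_gt0 // -subnS
           exprS mulN1r mulNr opprK.
Qed.

(** By uniqueness it suffices that the partial sums [P] satisfy the recursion: removing [e] from [S]
    leaves the terms with [e \in Q], which form the Shapley value of the restriction. *)
Lemma potential_of_sum (K : realType) (N : finType) (v : game K N)
    (d : {set N} -> K[i]) :
    (forall S, v S = \sum_(Q : {set N} | Q \subset S) d Q) ->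
  potential v = \sum_(Q : {set N}) #|Q|%:R^-1 * d Q.
Proof.
move=> vE.
pose P (S : {set N}) := \sum_(Q : {set N} | Q \subset S) #|Q|%:R^-1 * d Q.
suff /potential_unique potP : is_potential v P.
  rewrite /potential -(potP _ (svalP (cid (potential_exists v)))).
  by apply: eq_bigl => Q; rewrite subsetT.
split=> [|S e eS].
  rewrite /P big1 // => Q; rewrite subset0 => /eqP ->.
  by rewrite cards0 invr0 mul0r.
have divE : dividend (Defs.restrict v S) =1 (fun Q => d (val @: Q)).
  apply: dividend_of_sum => A /=; rewrite vE.
  rewrite -(@sum_imset_val _ _ _ (fun B => B \subset val @: A) (mem S)).
    apply: eq_bigl => B; apply/idP/idP => [/subsetP BA|]; last exact: imsetS.
    by apply/subsetP => f fB; rewrite -(mem_imset _ _ val_inj) BA ?imset_f.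
  move=> B; rewrite andb_idl // => /subset_trans; apply.
  by apply/subsetP => _ /imsetP[f _ ->]; exact: valP.
transitivity (\sum_(Q : {set N} | (Q \subset S) && (e \in Q)) #|Q|%:R^-1 * d Q).
  rewrite /P (bigID (fun Q : {set N} => e \in Q)) /=.
  rewrite [X in _ + X - _](eq_bigl (fun Q : {set N} => Q \subset S :\ e)).
    by rewrite addrK.
  by move=> Q; rewrite subsetD1.
rewrite -(@sum_imset_val _ _ _ (fun B => e \in B) (mem S)) //.
apply: eq_big => [Q|Q _]; last by rewrite divE (card_imset _ val_inj).
by rewrite -[e in LHS]/(val (exist (fun e => e \in S) e eS))
           (mem_imset _ _ val_inj).
Qed.

Lemma potential_augmented (K : realType) (G : multigraph) (w : game K (edge G)) (x : K[i]) :
  potential (augmented w x) =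
  \sum_(Q : {set edge G}) dividend w Q * x ^+ ncomponents Q.
Proof.
rewrite (@potential_of_sum _ _ _
  (fun Q => dividend w Q * (#|Q|%:R * x ^+ ncomponents Q))).
  (* For empty [Q] nothing cancels, since the inverse of 0 is 0; both sides vanish because
     [dividend w set0] is [w set0]. *)
  apply: eq_bigr => Q _; have [->|Q0] := eqVneq Q set0.
    rewrite cards0 invr0 mul0r /dividend (big_pred1 set0) => [|T].
      by rewrite worth0 mulr0 mul0r.
    by rewrite subset0.
  by rewrite mulrCA mulKf // pnatr_eq0 cards_eq0.
move=> S /=; rewrite big_mkcond [RHS]big_mkcond; apply: eq_bigr => Q _.
have [->|_ /=] := eqVneq Q set0; last by case: ifP => _; rewrite ?mulr0.
by rewrite sub0set cards0 mul0r mulr0.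
Qed.

(** * Connectivity and counting components *)

Lemma connect_invariant (T : finType) (U : Type) (r : rel T) (f : T -> U) :
    (forall a b, r a b -> f a = f b) ->
  forall a b, connect r a b -> f a = f b.
Proof.
move=> fr a b /connectP[p rp ->] {b}.
by elim: p a rp => //= c p IHp a /andP[/fr -> /IHp].
Qed.

(** Both images are in bijection with the image of the pair map, through its projections. This
    compares component counts living in different types. *)
Lemma card_imset_fibers (T U1 U2 : finType) (f : T -> U1) (g : T -> U2) :
    (forall a b, (f a == f b) = (g a == g b)) ->
  #|f @: T| = #|g @: T|.
Proof.
move=> fg; transitivity #|[set (f a, g a) | a in T]|.
  have -> : f @: T = fst @: [set (f a, g a) | a in T].
    by rewrite -imset_comp; apply: eq_imset.
  apply: card_in_imset => _ _ /imsetP[a _ ->] /imsetP[b _ ->] /= ab.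
  by move: (ab) => /eqP; rewrite fg => /eqP ->; rewrite ab.
have -> : g @: T = snd @: [set (f a, g a) | a in T].
  by rewrite -imset_comp; apply: eq_imset.
apply/esym/card_in_imset => _ _ /imsetP[a _ ->] /imsetP[b _ ->] /= ab.
by move: (ab) => /eqP; rewrite -fg => /eqP ->; rewrite ab.
Qed.

Section Components.

Context (G : multigraph).
Implicit Types (A B : {set edge G}) (u v : vertex G).

Lemma connect_adjC A : connect_sym (adj A).
Proof.
apply: sym_connect_sym => u v.
by apply: eq_existsb => e; rewrite orbC.
Qed.

Lemma connect_ends A e : e \in A -> connect (adj A) (ends e).1 (ends e).2.
Proof.
by move=> eA; apply/connect1/existsP; exists e; rewrite eA -surjective_pairing eqxx.
Qed.

Lemma component_of_eq A u v :
  (component_of A u == component_of A v) = connect (adj A) u v.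
Proof.
apply/eqP/idP => [/setP/(_ v)|uv]; first by rewrite !inE connect0.
by apply/setP => a; rewrite !inE (same_connect (connect_adjC A) uv).
Qed.

Lemma adj_invariant (U : Type) A (f : vertex G -> U) :
    (forall e, e \in A -> f (ends e).1 = f (ends e).2) ->
  forall u v, adj A u v -> f u = f v.
Proof.
move=> fA u v /existsP[e /andP[/fA]].
by case: (ends e) => a b /= ab /orP[] /eqP[<- <-].
Qed.

Lemma connect_adj_sub A B u v :
  A \subset B -> connect (adj A) u v -> connect (adj B) u v.
Proof.
move=> /subsetP AB; apply: connect_sub => a b ab; apply: connect1.
by case/existsP: ab => e /andP[/AB eB ab]; apply/existsP; exists e; rewrite eB.
Qed.

(* The component of [B] containing a given component of a subset of [B]. *)
Definition saturate B (X : {set vertex G}) : {set vertex G} :=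
  [set v | [exists u in X, connect (adj B) u v]].

Lemma saturate_component A B v :
  A \subset B -> saturate B (component_of A v) = component_of B v.
Proof.
move=> AB; apply/setP => a; rewrite !inE.
apply/existsP/idP => [[u /andP[]]|va]; last first.
  by exists v; rewrite inE connect0.
by rewrite inE => /(connect_adj_sub AB) vu; exact: connect_trans.
Qed.

Lemma components_saturate A B :
  A \subset B -> components B = saturate B @: components A.
Proof.
move=> AB; rewrite /components -imset_comp; apply: eq_imset => v /=.
by rewrite saturate_component.
Qed.

(** Saturation maps the components of [A] onto those of [e |: A]. If the count does not drop it is
    injective, so the ends of [e], joined in [e |: A], were already joined in [A]. *)
Lemma nonflat_connect A :
  ~~ flat A -> exists2 e, e \notin A & connect (adj A) (ends e).1 (ends e).2.
Proof.
case/forallPn => e; rewrite negb_imply -leqNgt => /andP[eA le_nc].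
exists e => //; have sA := subsetU1 e A.
rewrite -component_of_eq; apply/eqP.
have /imset_injP inj_sat :
    #|saturate (e |: A) @: components A| == #|components A|.
  by rewrite eqn_leq leq_imset_card -components_saturate.
apply: inj_sat; rewrite ?component_of_in // !saturate_component //.
by apply/eqP; rewrite component_of_eq connect_ends ?setU11.
Qed.

Lemma ncomponents_setU1 A e :
  connect (adj A) (ends e).1 (ends e).2 -> ncomponents (e |: A) = ncomponents A.
Proof.
move=> cA; apply: card_imset_fibers => u v; rewrite !component_of_eq.
apply/idP/idP; last exact/connect_adj_sub/subsetU1.
move/(connect_invariant (f := component_of A)) => uv.
rewrite -component_of_eq; apply/eqP/uv => {u v uv}.
apply: adj_invariant => f /setU1P[->|fA]; apply/eqP; rewrite component_of_eq //.
exact: connect_ends.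
Qed.

End Components.

(** * Contraction and its chromatic polynomial *)

Section Contraction.

Context (G : multigraph) (T : {set edge G}).

Lemma connect_contract (A : {set edge (contract T)}) (u v : vertex G) :
  connect (adj A) (contract_proj T u) (contract_proj T v) =
  connect (adj (T :|: val @: A)) u v.
Proof.
set B := T :|: _; have TB : T \subset B by exact: subsetUl.
apply/idP/idP.
  (* A contracted vertex is a component of [T]; the component of [B] around it is constant along
     edges of [A]. *)
  move/(connect_invariant (f := fun X => saturate B (val X))) => uv.
  rewrite -component_of_eq; apply/eqP.
  rewrite -!(saturate_component _ TB); apply: uv.
  apply: (@adj_invariant (contract T) _ A (fun X => saturate B (val X))).
  move=> e eA /=; rewrite !saturate_component //.
  apply/eqP; rewrite component_of_eq connect_ends // inE.
  by apply/orP; right; exact: imset_f.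
(* Conversely, an edge of [T] has ends with equal projections, and any other edge of [B] comes from
   [A]. *)
move/(connect_invariant (f := fun a => component_of A (contract_proj T a))) => uv.
rewrite -component_of_eq; apply/eqP/uv => {u v uv}.
apply: adj_invariant => e /setUP[eT|/imsetP[f fA ->]].
  congr component_of; apply: val_inj => /=; apply/eqP.
  by rewrite component_of_eq connect_ends.
by apply/eqP; rewrite component_of_eq; exact: (connect_ends fA).
Qed.

Lemma ncomponents_contract (A : {set edge (contract T)}) :
  ncomponents A = ncomponents (T :|: val @: A).
Proof.
transitivity #|[set component_of A (contract_proj T v) | v : vertex G]|.
  congr #|pred_of_set _|; apply/setP => X; apply/imsetP/imsetP => [[]|[v _ ->]].
    by move=> [Y /[dup] /imsetP[v _ ->] vT] _ ->; exists v => //;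
      congr component_of; exact: val_inj.
  by exists (contract_proj T v).
by apply: card_imset_fibers => u v; rewrite !component_of_eq connect_contract.
Qed.

Context (K : realType) (x : K[i]).

(** Edge sets [A] of the contraction correspond to the sets [Q] containing [T] by [Q = T :|: A],
    which preserves the component count. *)
Lemma chromatic_contract :
  chromatic (contract T) x =
  \sum_(Q : {set edge G} | T \subset Q)
     (-1) ^+ (#|Q| - #|T|) * x ^+ ncomponents Q.
Proof.
transitivity (\sum_(A : {set edge G} | A \subset ~: T)
                (-1) ^+ #|A| * x ^+ ncomponents (T :|: A)).
  rewrite -(@sum_imset_val _ _ _ xpredT (fun e => e \notin T)) => [|A].
    by apply: eq_bigr => A _; rewrite ncomponents_contract (card_imset _ val_inj).
  rewrite andbT; apply/subsetP/subsetP => AT e /AT; by rewrite inE.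
rewrite [RHS](reindex_onto (setU T) (fun Q => Q :\: T)) => [|Q TQ]; last first.
  by rewrite setDE setUIr setUCr setIT; exact/setUidPr.
apply: eq_big => [A|A].
  rewrite subsetUl setDUl setDv set0U /=.
  by rewrite -disjoints_subset; apply: (sameP setDidPl eqP).
rewrite -disjoints_subset => dAT.
by rewrite cardsU setIC (disjoint_setI0 dAT) cards0 subn0 addKn.
Qed.

Lemma chromatic_contract_nonflat : ~~ flat T -> chromatic (contract T) x = 0.
Proof.
case/nonflat_connect => e eT cT; rewrite chromatic_contract.
apply: (sum_toggle0 (e := e)) => Q eQ; first by rewrite subset_setU1.
move=> TQ; rewrite cardsU1 eQ add1n subSn ?subset_leq_card // exprS mulN1r mulNr.
by rewrite ncomponents_setU1 //; exact: connect_adj_sub cT.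
Qed.

End Contraction.

(** Contracting nothing still changes the vertex and edge types, so the comparison goes through the
    subset expansion. *)
Lemma chromatic_contract0 (K : realType) (G : multigraph) (x : K[i]) :
  chromatic (contract (set0 : {set edge G})) x = chromatic G x.
Proof.
rewrite chromatic_contract; apply: eq_big => [Q|Q _]; first by rewrite sub0set.
by rewrite cards0 subn0.
Qed.

(** * The potential as a sum over flats *)

Lemma potential_augmented_flat (K : realType) (G : multigraph)
    (w : game K (edge G)) (x : K[i]) :
  potential (augmented w x) =
  \sum_(T : {set edge G} | flat T) w T * chromatic (contract T) x.
Proof.
rewrite potential_augmented /dividend.
under eq_bigr do rewrite mulr_suml.
rewrite (exchange_big_dep xpredT) //= [RHS]big_mkcond; apply: eq_bigr => T _.
transitivity (w T * chromatic (contract T) x).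
  rewrite chromatic_contract mulr_sumr.
  by apply: eq_bigr => Q _; rewrite mulrAC mulrC.
by case: ifPn => // /chromatic_contract_nonflat ->; rewrite mulr0.
Qed.

Theorem theorem11 (K : realType) (G : multigraph) (x : K[i])
    (w : {set edge G} -> rat) (w_ge0 : forall A : {set edge G}, 0 <= w A)
    (w0 : w set0 = 0)
    (w_couple : forall A : {set edge G},
        A != set0 -> w A = \prod_(e in A) w [set e]) :
  potential (augmented (rat_game K w0) x)
    = \sum_(T : {set edge G} | flat T) ratr (w T) * chromatic (contract T) x
  /\
  \sum_(T : {set edge G} | flat T) ratr (w T) * chromatic (contract T) x
    = bad_coloring x (fun e => ratr (w [set e])) - chromatic G x.
Proof.
split; first exact: potential_augmented_flat.
rewrite /bad_coloring big_mkcond [in RHS]big_mkcond /=.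
(* The couple identity covers nonempty sets only. The empty set gives 0 on the left, and on the
   right C(G, x) times an empty product, cancelled by the subtracted C(G, x). *)
rewrite (bigD1 set0) //= [in RHS](bigD1 set0) //= -addrA addrC addrCA.
rewrite w0 rmorph0 mul0r big_set0 mulr1 chromatic_contract0.
have -> : (if flat (set0 : {set edge G}) then chromatic G x else 0)
          = chromatic G x.
  case: ifPn => // /(chromatic_contract_nonflat x).
  by rewrite chromatic_contract0.
rewrite if_same addr0 subrr addr0; apply: eq_bigr => T T0.
by rewrite w_couple // rmorph_prod mulrC.
Qed.
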